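(* Let $M=(ST,AC,\{av_C\}_{C\subseteq AG},\{out_C\}_{C\subseteq AG},L)$ be an action model and $s\in ST$. The following three sets of conditions are equivalent: (1) (a) for all $a\in AG$, $\bigcup\{out_{\{a\}}(s,\sigma_a)\mid\sigma_a\in JA_{\{a\}}\}=out_\emptyset(s,\emptyset)$; and (b) for all nonempty $C\subseteq AG$ and $\sigma_C\in JA_C$, $out_C(s,\sigma_C)=\bigcap\{out_{\{a\}}(s,\sigma_C|_{\{a\}})\mid a\in C\}$. (2) (a) for all $a\in AG$, $\bigcup\{out_{\{a\}}(s,\sigma_a)\mid\sigma_a\in JA_{\{a\}}\}=out_\emptyset(s,\emptyset)$; and (b) for all $C,D\subseteq AG$ with $C\cap D=\emptyset$, $\sigma_C\in JA_C$, $\sigma_D\in JA_D$: $out_{C\cup D}(s,\sigma_C\cup\sigma_D)=out_C(s,\sigma_C)\cap out_D(s,\sigma_D)$. (3) (a) for all $C\subseteq AG$ and $\sigma_C\in JA_C$, $out_C(s,\sigma_C)=\bigcup\{out_{AG}(s,\sigma_{AG})\mid\sigma_{AG}\in JA_{AG},\ \sigma_C\subseteq\sigma_{AG}\}$; and (b) for all $C\subseteq AG$ and $\sigma_C,\sigma'_C,\sigma''_C\in JA_C$, if $\sigma''_C$ is a fusion of $\sigma_C$ and $\sigma'_C$, then $out_C(s,\sigma_C)\cap out_C(s,\sigma'_C)\subseteq out_C(s,\sigma''_C)$.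
   Context: $AG$ is a finite nonempty set of agents; $AP$ a countable set of atomic propositions. For a nonempty set $AC$ of actions and $C\subseteq AG$, $JA_C$ is the set of all functions $\sigma_C:C\to AC$ ($JA_\emptyset=\{\emptyset\}$). For $D\subseteq C$, $\sigma_C|_D$ is the restriction; $\sigma_D\subseteq\sigma_C$ means $\sigma_D=\sigma_C|_D$; $\sigma_a$ denotes an element of $JA_{\{a\}}$. For disjoint $C,D$, $\sigma_C\cup\sigma_D\in JA_{C\cup D}$ is the union of functions. An action model is a tuple $(ST,AC,\{av_C\}_{C\subseteq AG},\{out_C\}_{C\subseteq AG},L)$ with $ST$ a nonempty set, $AC$ a nonempty set, $av_C:ST\to\mathcal P(JA_C)$, $out_C:ST\times JA_C\to\mathcal P(ST)$, $L:ST\to\mathcal P(AP)$. For $\sigma_C,\sigma'_C,\sigma''_C\in JA_C$, $\sigma''_C$ is a fusion of $\sigma_C$ and $\sigma'_C$ if for every $a\in C$, $\sigma''_C|_{\{a\}}$ equals $\sigma_C|_{\{a\}}$ or $\sigma'_C|_{\{a\}}$. *)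

(* Defs.v *)
From HB Require Import structures.
From mathcomp Require Import all_boot.
From mathcomp Require Import boolp classical_sets.

Set Implicit Arguments.
Unset Strict Implicit.
Unset Printing Implicit Defensive.

Local Open Scope classical_set_scope.

(* finset and classical_sets share several notations: coalitions C : {set AG}
   are finite sets (delimiter %SET), whereas sets of states, of joint actions
   and of atomic propositions are classical sets. *)

Section JointActions.
Variables (AG : finType) (AC : Type).
Implicit Types C D : {set AG}.

Definition member C : finType := {a : AG | a \in C}.

Definition JA C : Type := {ffun member C -> AC}.

Definition ja_restr C D (sDC : D \subset C) (sigma : JA C) : JA D :=
  [ffun x : member D => sigma (exist _ (val x) (fintype.subsetP sDC _ (valP x)))].

Lemma member_sub1 C (a : member C) : [set val a]%SET \subset C.
Proof. by rewrite finset.sub1set (valP a). Qed.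

Definition ja_restr1 C (sigma : JA C) (a : member C) : JA [set val a]%SET :=
  ja_restr (member_sub1 a) sigma.

Definition ja_sub D C (sigmaD : JA D) (sigmaC : JA C) : Prop :=
  exists sDC : D \subset C, sigmaD = ja_restr sDC sigmaC.

Lemma member0F (x : member finset.set0) : False.
Proof. by case: x => a; rewrite finset.in_set0. Qed.

Definition ja_empty : JA finset.set0 :=
  [ffun x => False_rect AC (member0F x)].

Lemma in_setU_notinl C D (a : AG) : a \in C :|: D -> ~ a \in C -> a \in D.
Proof. by case/finset.setUP. Qed.

(* On C :&: D the value is that of sigmaC; only used for disjoint C and D. *)
Definition ja_union C D (sigmaC : JA C) (sigmaD : JA D) : JA (C :|: D) :=
  [ffun x : member (C :|: D) =>
    match decP (@idP (val x \in C)) with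
    | left aC => sigmaC (exist _ (val x) aC)
    | right aNC => sigmaD (exist _ (val x) (in_setU_notinl (valP x) aNC))
    end].

Lemma ja_restr_unionl C D (sigmaC : JA C) (sigmaD : JA D) :
  ja_restr (finset.subsetUl C D) (ja_union sigmaC sigmaD) = sigmaC.
Proof.
apply/ffunP => -[a aC]; rewrite !ffunE /=.
case: decP => // aC'.
by congr (sigmaC _); apply: val_inj.
Qed.

Lemma ja_restr_unionr C D (sigmaC : JA C) (sigmaD : JA D) :
  C :&: D = finset.set0 ->
  ja_restr (finset.subsetUr C D) (ja_union sigmaC sigmaD) = sigmaD.
Proof.
move=> CD0; apply/ffunP => -[a aD]; rewrite !ffunE /=.
case: decP => [aC|aNC].
  by have := finset.in_set0 a; rewrite -CD0 finset.inE aC aD.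
by congr (sigmaD _); apply: val_inj.
Qed.

(* sigma'' is a fusion of sigma and sigma'. *)
Definition fusion C (sigma sigma' sigma'' : JA C) : Prop :=
  forall a : member C,
    ja_restr1 sigma'' a = ja_restr1 sigma a \/
    ja_restr1 sigma'' a = ja_restr1 sigma' a.

End JointActions.

Arguments ja_empty {AG AC}.

(* states, actions and label are the components ST, AC and L of the tuple. *)
Record action_model (AG : finType) (AP : countType) := ActionModel {
  states : Type;
  actions : Type;
  states_nonempty : inhabited states;
  actions_nonempty : inhabited actions;
  av : forall C : {set AG}, states -> set (JA actions C);
  out : forall C : {set AG}, states -> JA actions C -> set states;
  label : states -> set AP
}.

Arguments av {AG AP} M C s : rename.
Arguments out {AG AP} M C s sigma : rename.

(* Main.v *)
(* Since there is at least one action, every joint action of C is the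
   restriction to C of a total function f : AG -> AC, so out is a family O C f
   that depends only on the values of f on C. Each of the three sets of
   conditions says that (a) holds and that x is in O C f iff x is in O set0 f and
   in O {a} f for all a in C. From (3), one member of C at a time, fusion changes
   a profile of the grand coalition leading to x into one that agrees with f
   on C; towards (3), the agents outside C choose by (a) actions allowing x. *)
Require Import Defs.
From HB Require Import structures.
From mathcomp Require Import all_boot.
From mathcomp Require Import boolp classical_sets.

Set Implicit Arguments.
Unset Strict Implicit.
Unset Printing Implicit Defensive.

Local Open Scope classical_set_scope.


(** * Conditions on outcome families indexed by total action profiles *)

Section ActionProfiles.
Variables (AG : finType) (AC ST : Type).
Variable O : {set AG} -> (AG -> AC) -> set ST.
Implicit Types (C D : {set AG}) (f g h : AG -> AC).

Definition glue C f g : AG -> AC := fun a => if a \in C then f a else g a.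

Definition profile_local : Prop := forall C f g, {in C, f =1 g} -> O C f = O C g.

(** [O set0 f] stands for the outcome set of the empty joint action: under [profile_local] it is one
    and the same set for all [f]. *)
Definition agent_cover : Prop :=
  forall a f x, (exists g, O [set a]%SET g x) <-> O finset.set0 f x.

Definition pointwise_out : Prop :=
  forall C f x, C != finset.set0 ->
    O C f x <-> forall a, a \in C -> O [set a]%SET f x.

Definition additive_out : Prop :=
  forall C D f g x, C :&: D = finset.set0 ->
    O (C :|: D) (glue C f g) x <-> O C f x /\ O D g x.

Definition grand_determined : Prop :=
  forall C f x, O C f x <-> exists2 g, {in C, f =1 g} & O [set: AG]%SET g x.

Definition fusion_closed : Prop :=
  forall C f g h x, (forall a, a \in C -> h a = f a \/ h a = g a) ->
    O C f x -> O C g x -> O C h x.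

(** Common normal form for the three sets of conditions; the conjunct on [set0] makes the
    equivalence meaningful for empty [C] as well. *)
Definition pointwise_out0 : Prop :=
  forall C f x,
    O C f x <-> O finset.set0 f x /\ forall a, a \in C -> O [set a]%SET f x.

Hypothesis O_local : profile_local.

Lemma O0_irrelevant f g : O finset.set0 f = O finset.set0 g.
Proof. by apply: O_local => a; rewrite finset.in_set0. Qed.

Lemma O1_local a f g : f a = g a -> O [set a]%SET f = O [set a]%SET g.
Proof. by move=> fg; apply: O_local => b /finset.set1P ->. Qed.

(** By [agent_cover], the outcomes of any single agent lie in [O set0 f], so for nonempty [C] the
    extra conjunct comes for free; for empty [C] the normal form is trivial. *)
Lemma pointwise_out0P :
  agent_cover -> pointwise_out <-> pointwise_out0.
Proof.
move=> cover; split=> H C f x.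
  have [->|C0] := eqVneq C finset.set0.
    by split=> [Ox|[]//]; split=> // a; rewrite finset.in_set0.
  split=> [Ox|[_ Ox]]; last exact/H.
  move/(H _ _ _ C0): Ox => Ox; split=> //.
  have [a aC] := finset.set0Pn _ C0.
  by apply/(cover a); exists f; exact: Ox.
move=> /finset.set0Pn[a aC]; split=> [/H[]//|Ox].
apply/H; split=> //.
by apply/(cover a); exists f; exact: Ox.
Qed.

Lemma additive_outP :
  agent_cover -> additive_out <-> pointwise_out0.
Proof.
move=> cover; split=> H.
  have split_out C D f x : C :&: D = finset.set0 ->
      O (C :|: D) f x <-> O C f x /\ O D f x.
    move=> CD0; rewrite -H //.
    by rewrite (_ : glue C f f = f) //; apply/funext=> a; rewrite /glue if_same.
  (* Additivity for the disjoint pieces [C :&: D = D] and [C :\: D] of [C] gives monotonicity. *)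
  have mono C D f x : D \subset C -> O C f x -> O D f x.
    move=> DC; rewrite -[in O C](finset.setID C D) (finset.setIidPr DC).
    rewrite split_out => [[]//|].
    by apply/finset.setP => a; rewrite !finset.inE; case: (a \in D).
  move=> C f x; split=> [Ox|[O0 O1]].
    split; first by apply: mono Ox; rewrite finset.sub0set.
    by move=> a aC; apply: mono Ox; rewrite finset.sub1set.
  (* The coalition is built up by one singleton at a time; an agent already in the list leaves the
     set unchanged, and a new one is disjoint from it. *)
  have cons_out (s : seq AG) : {subset s <= C} -> O [set a in s]%SET f x.
    elim: s => [_|a s IH sC]; first by rewrite finset.set_nil.
    have Os : O [set a in s]%SET f x.
      by apply: IH => b bs; apply: sC; rewrite inE bs orbT.
    rewrite finset.set_cons; have [as_|as_] := boolP (a \in s).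
      by rewrite (finset.setUidPr _) // finset.sub1set finset.inE.
    apply/split_out; last by split=> //; apply/O1/sC; rewrite mem_head.
    apply/eqP; rewrite finset.setI_eq0 finset.disjoints1.
    by rewrite finset.inE.
  by rewrite -(finset.set_enum C); apply: cons_out => a; rewrite mem_enum.
move=> C D f g x CD0; rewrite (H (C :|: D)) (H C) (H D).
have glueC a : a \in C -> O [set a]%SET (glue C f g) = O [set a]%SET f.
  by move=> aC; apply: O1_local; rewrite /glue aC.
have glueD a : a \in D -> O [set a]%SET (glue C f g) = O [set a]%SET g.
  move=> aD; apply: O1_local; rewrite /glue ifN //; apply/negP=> aC.
  by have := finset.in_set0 a; rewrite -CD0 finset.inE aC aD.
rewrite (O0_irrelevant (glue C f g) f) (O0_irrelevant g f).
split=> [[O0 O1]|[[O0 O1] [_ O2]]].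
  split; split=> // a aX; first by rewrite -glueC //; apply: O1; rewrite finset.inE aX.
  by rewrite -glueD //; apply: O1; rewrite finset.inE aX orbT.
split=> // a /finset.setUP[aX|aX]; first by rewrite glueC //; exact: O1.
by rewrite glueD //; exact: O2.
Qed.

Lemma grand_fusionP :
  grand_determined /\ fusion_closed <-> agent_cover /\ pointwise_out0.
Proof.
split=> [[grand fus]|[cover H]].
  have shrink C f x : O [set: AG]%SET f x -> O C f x by move=> Ox; apply/grand; exists f.
  split.
    (* Both directions pass through a profile of the grand coalition leading to [x], which is then
       shrunk to [set0] or to the singleton of [a]. *)
    move=> a f x; split=> [[g /grand[h _ /(@shrink finset.set0)]]|/grand[g _ Ox]].
      by rewrite (O0_irrelevant h f).
    by exists g; exact: shrink.
  move=> C f x; split=> [/grand[g fg Og]|[O0 O1]].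
    split; first by rewrite (O0_irrelevant f g); exact: shrink.
    by move=> a aC; rewrite (O1_local (fg a aC)); exact: shrink.
  have adjust (s : seq AG) : {subset s <= C} ->
      exists2 g, {in s, f =1 g} & O [set: AG]%SET g x.
    elim: s => [_|a s IH sC]; first by move/grand: O0 => [g _ Og]; exists g.
    have [|g fg Og] := IH; first by move=> b bs; apply: sC; rewrite inE bs orbT.
    have /grand[h fh Oh] := O1 a (sC a (mem_head a s)).
    (* As [h] agrees with [f] at [a], changing [g] at [a] alone extends the agreement with [f] to
       [a :: s]; the result is a fusion of [h] and [g] on all of [AG]. *)
    exists (glue [set a]%SET h g).
      move=> b; rewrite inE /glue finset.in_set1; case: eqVneq => [->|_] /=.
        by rewrite fh ?finset.set11.
      exact: fg.
    by apply: fus Oh Og => b _; rewrite /glue; case: ifP; [left|right].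
  have [|g fg Og] := adjust (enum C); first by move=> a; rewrite mem_enum.
  by apply/grand; exists g => // a aC; apply: fg; rewrite mem_enum.
split.
  move=> C f x; split=> [/H[O0 O1]|[g fg /H[O0 O1]]].
    (* For each agent [a], the cover yields a profile [c a] whose action at [a] allows [x]. The
       diagonal [c a a] collects these actions into one profile, used outside [C]. *)
    have [c cP] : {c : AG -> AG -> AC & forall a, O [set a]%SET (c a) x}.
      by apply: (@choice _ _ (fun a g => O [set a]%SET g x)) => a; apply/cover/O0.
    exists (glue C f (fun a => c a a)).
      by move=> a aC; rewrite /glue aC.
    apply/H; split; first by rewrite (O0_irrelevant _ f).
    move=> a _; have [aC|aC] := boolP (a \in C).
      by rewrite (O1_local (g := f)) ?/glue ?aC //; exact: O1.
    by rewrite (O1_local (g := c a)) // /glue ifN.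
  rewrite (O_local fg); apply/H; split=> // a _.
  by apply: O1; rewrite finset.inE.
move=> C f g h x hfg /H[O0 Of] /H[_ Og]; apply/H; split.
  by rewrite (O0_irrelevant h f).
move=> a aC; have [ha|ha] := hfg a aC; rewrite (O1_local ha); [exact: Of|exact: Og].
Qed.

End ActionProfiles.

(** * Joint actions as restrictions of total profiles *)

Section JointActionOfProfile.
Variables (AG : finType) (AC : Type).
Implicit Types (C D : {set AG}) (f g h : AG -> AC).

Definition ja_of C f : JA AC C := [ffun x : member C => f (val x)].

(** Outside [C] the joint action is extended by a constant default action. *)
Lemma ja_of_surj (AC0 : inhabited AC) C (sigma : JA AC C) :
  exists f, sigma = ja_of C f.
Proof.
case: AC0 => c; exists (fun a => if insub a is Some b then sigma b else c).
by apply/ffunP => b; rewrite ffunE valK.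
Qed.

Lemma eq_ja_of C f g : ja_of C f = ja_of C g <-> {in C, f =1 g}.
Proof.
split=> [fg a aC|fg].
  by have := congr1 (fun sigma : JA AC C => sigma (exist _ a aC)) fg; rewrite !ffunE.
by apply/ffunP => -[a aC]; rewrite !ffunE /=; exact: fg.
Qed.

Lemma ja_restr_of C D (sDC : D \subset C) f :
  ja_restr sDC (ja_of C f) = ja_of D f.
Proof. by apply/ffunP => a; rewrite !ffunE. Qed.

Lemma ja_restr1_of C f (a : member C) :
  ja_restr1 (ja_of C f) a = ja_of [set val a]%SET f.
Proof. exact: ja_restr_of. Qed.

Lemma ja_empty_of f : ja_empty = ja_of finset.set0 f.
Proof. by apply/ffunP => a; case: (member0F a). Qed.

(** On an overlap of [C] and [D], both [ja_union] and [glue] take the value from [C]. *)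
Lemma ja_union_of C D f g :
  ja_union (ja_of C f) (ja_of D g) = ja_of (C :|: D) (glue C f g).
Proof.
apply/ffunP => a; rewrite !ffunE /glue.
by case: decP => aC; rewrite ffunE /= ?aC //; move/negP/negbTE: aC => ->.
Qed.

Lemma ja_sub_of C D f g :
  D \subset C -> ja_sub (ja_of D f) (ja_of C g) <-> {in D, f =1 g}.
Proof.
move=> sDC; rewrite -eq_ja_of; split=> [[s]|fg]; first by rewrite ja_restr_of.
by exists sDC; rewrite ja_restr_of.
Qed.

Lemma fusion_of C f g h :
  fusion (ja_of C f) (ja_of C g) (ja_of C h) <->
  forall a, a \in C -> h a = f a \/ h a = g a.
Proof.
split=> [H a aC|H [a aC]].
  by have := H (exist _ a aC); rewrite !ja_restr1_of !eq_ja_of;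
    case=> /(_ a (finset.set11 a)); [left|right].
rewrite !ja_restr1_of !eq_ja_of /=.
by have [ha|ha] := H a aC; [left|right] => b /finset.set1P ->.
Qed.

End JointActionOfProfile.

Theorem theorem4p5 (AG : finType) (AP : countType) (AG_nonempty : 0 < #|AG|)
    (M : action_model AG AP) (s : states M) :
  let cond1 :=
    (forall a : AG,
       \bigcup_(sigma in [set: JA (actions M) [set a]%SET]) out M [set a]%SET s sigma
       = out M finset.set0 s ja_empty)
    /\
    (forall (C : {set AG}) (sigma : JA (actions M) C), C != finset.set0 ->
       out M C s sigma
       = \bigcap_(a in [set: member C])
           out M [set val a]%SET s (ja_restr1 sigma a)) in
  let cond2 :=
    (forall a : AG,
       \bigcup_(sigma in [set: JA (actions M) [set a]%SET]) out M [set a]%SET s sigma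
       = out M finset.set0 s ja_empty)
    /\
    (forall (C D : {set AG}) (sigmaC : JA (actions M) C) (sigmaD : JA (actions M) D),
       C :&: D = finset.set0 ->
       out M (C :|: D) s (ja_union sigmaC sigmaD)
       = out M C s sigmaC `&` out M D s sigmaD) in
  let cond3 :=
    (forall (C : {set AG}) (sigmaC : JA (actions M) C),
       out M C s sigmaC
       = \bigcup_(sigma in [set sigma : JA (actions M) [set: AG]%SET |
                              ja_sub sigmaC sigma])
           out M [set: AG]%SET s sigma)
    /\
    (forall (C : {set AG}) (sigma sigma' sigma'' : JA (actions M) C),
       fusion sigma sigma' sigma'' ->
       out M C s sigma `&` out M C s sigma' `<=` out M C s sigma'') in
  (cond1 <-> cond2) /\ (cond2 <-> cond3).
Proof.
move=> cond1 cond2 cond3.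
have surj := @ja_of_surj AG _ (actions_nonempty M).
pose O (C : {set AG}) (f : AG -> actions M) := out M C s (ja_of C f).
have O_local : profile_local O by move=> C f g /eq_ja_of fg; rewrite /O fg.
(* The constant profile [f0] serves to write [ja_empty] as a restriction. *)
have [c] := actions_nonempty M; pose f0 (_ : AG) := c.
have coverP : (forall a : AG,
    \bigcup_(sigma in [set: JA (actions M) [set a]%SET]) out M [set a]%SET s sigma
    = out M finset.set0 s ja_empty) <-> agent_cover O.
  split=> H a.
    move=> f x; rewrite /O -ja_empty_of -(H a).
    split=> [[g Og]|[sigma _ Os]]; first by exists (ja_of [set a]%SET g).
    by have [g sg] := surj _ sigma; exists g; rewrite -sg.
  rewrite (ja_empty_of f0); apply/seteqP; split=> x.
    move=> [sigma _]; have [g ->] := surj _ sigma => Og.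
    by apply/(H a f0); exists g.
  by move/(H a f0) => [g Og]; exists (ja_of [set a]%SET g).
have cond1P : cond1 <-> agent_cover O /\ pointwise_out O.
  rewrite /cond1 coverP; split=> -[cover H]; split=> // C.
    move=> f x C0; rewrite /O H //; split=> Ox.
      by move=> a aC; have := Ox (exist _ a aC) I; rewrite ja_restr1_of.
    by move=> a _; rewrite ja_restr1_of; exact/Ox/valP.
  move=> sigma C0; have [f ->] := surj _ sigma.
  apply/seteqP; split=> x.
    by move=> /(H _ _ _ C0) Ox a _; rewrite ja_restr1_of; exact/Ox/valP.
  move=> Ox; apply/(H _ _ _ C0) => a aC.
  by have := Ox (exist _ a aC) I; rewrite ja_restr1_of.
have cond2P : cond2 <-> agent_cover O /\ additive_out O.
  rewrite /cond2 coverP; split=> -[cover H]; split=> // C D.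
    by move=> f g x CD0; rewrite /O -ja_union_of H.
  move=> sigmaC sigmaD CD0.
  have [f ->] := surj _ sigmaC; have [g ->] := surj _ sigmaD.
  by rewrite ja_union_of; apply/seteqP; split=> x /(H _ _ _ _ _ CD0).
have cond3P : cond3 <-> grand_determined O /\ fusion_closed O.
  split=> -[grand fus]; split=> C.
  - move=> f x; rewrite /O grand; split=> [[sigma /= sub Os]|[g fg Og]].
      have [g sg] := surj _ sigma; exists g; last by rewrite -sg.
      by apply/(ja_sub_of _ _ (finset.subsetT C)); rewrite -sg.
    by exists (ja_of [set: AG]%SET g) => //=; apply/ja_sub_of; rewrite ?finset.subsetT.
  - by move=> f g h x /fusion_of fgh Of Og; exact: (fus _ _ _ _ fgh).
  - move=> sigmaC; have [f ->] := surj _ sigmaC; apply/seteqP; split=> x.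
      move=> /grand[g fg Og]; exists (ja_of [set: AG]%SET g) => //=.
      by apply/ja_sub_of; rewrite ?finset.subsetT.
    move=> [sigma /=]; have [g ->] := surj _ sigma => sub Og.
    apply/grand; exists g => //.
    exact/(ja_sub_of _ _ (finset.subsetT C)).
  - move=> sigma sigma' sigma''.
    have [f ->] := surj _ sigma; have [g ->] := surj _ sigma'.
    have [h ->] := surj _ sigma''.
    by move=> /fusion_of fgh x [Of Og]; exact: fus fgh Of Og.
(* The third set is now in normal form. The reductions of the other two presuppose the cover, so
   that conjunct is split off before they are applied. *)
rewrite cond1P cond2P cond3P (grand_fusionP O_local).
have p1 := @pointwise_out0P _ _ _ O; have p2 := additive_outP O_local.
by split; split=> -[cover H]; split=> //; move: H;
  rewrite ?(p1 cover) ?(p2 cover).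
Qed.
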